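(* Let $u_0, r \ge 1$ be integers with $\gcd(u_0, r) = 1$, and for each integer $k \ge 0$ put $u_k := u_0 + kr$. For each integer $n \ge 0$ let $L_n := \mathrm{lcm}(u_0, u_1, \ldots, u_n)$. Let $a \ge 2$ be any given integer. Then for any integer $\alpha \ge a$, if $r \ge a$, then for every integer $n \ge 3\alpha r$ we have $$L_n \ge u_0\, r^{2\alpha + a - 3}\,(r+1)^n.$$
   Context: Here $\mathrm{lcm}(u_0,\ldots,u_n)$ denotes the least common multiple of the positive integers $u_0, \ldots, u_n$. *)

(* Defs.v *)
From mathcomp Require Import all_boot.

Set Implicit Arguments.
Unset Strict Implicit.
Unset Printing Implicit Defensive.

Definition ap_term (u0 r k : nat) : nat := u0 + k * r.

(* The range [i < n.+1] runs over the n + 1 indices 0, ..., n. *)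
Definition ap_lcm (u0 r n : nat) : nat :=
  \big[lcmn/1]_(i < n.+1) ap_term u0 r i.

(* Main.v *)
Require Import Defs.
From mathcomp Require Import all_boot.
From mathcomp Require Import zify.

(** Write [u_i = u0 + i r] and [m = n - k].  Since [gcd(u0, r) = 1], the product
    [u_k ... u_n] divides [lcm(u_k, ..., u_n) * m!].  All the [u_i] are coprime
    to [r], so the cofactor is divisible by every power of [r] dividing [m!],
    in particular by [r ^ e] as soon as [e r <= m].  The quotient
    [u_k ... u_n / m!] is largest at [k = ceil ((n - u0) / (r + 1))]
    ([k = 0] if [n < u0]), where it is at least [u0 (r + 1) ^ n]; for this [k],
    [e (r + 1) <= n] implies [e r <= m],
    and [n >= 3 alpha r] gives the former with [e = 2 alpha + a - 3]. *)

Lemma prod_ap_recl (r x m : nat) :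
  \prod_(i < m.+1) (x + i * r) = x * \prod_(i < m) (x + r + i * r).
Proof.
rewrite big_ord_recl mul0n addn0; congr (_ * _).
by apply: eq_bigr => i _; rewrite lift0 mulSn addnA.
Qed.

(* With [P] the product of the inner terms and [x], [y = x + m.+1 * r] the outer
   ones, [x * P] and [P * y] both divide [N = L * m`! * r ^ m], hence [x * P * y]
   divides [N * y - N * x = N * (m.+1 * r)]. *)
Lemma prod_ap_dvdn_mul_expn (r L m x : nat) :
  (forall i, i <= m -> x + i * r %| L) ->
  \prod_(i < m.+1) (x + i * r) %| L * m`! * r ^ m.
Proof.
elim: m x => [|m IHm] x dvL.
  by rewrite big_ord1 !muln1; apply: dvL.
have xP_dvd : \prod_(i < m.+1) (x + i * r) %| L * m`! * r ^ m.
  by apply: IHm => i le_im; apply: dvL; apply: leqW.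
have Py_dvd : \prod_(i < m.+1) (x + r + i * r) %| L * m`! * r ^ m.
  by apply: IHm => i le_im; rewrite -addnA -mulSn; apply: dvL.
rewrite prod_ap_recl big_ord_recr /=.
rewrite prod_ap_recl in xP_dvd; rewrite big_ord_recr /= in Py_dvd.
rewrite -addnA -mulSn in Py_dvd *.
move: xP_dvd Py_dvd.
set P := \prod_(i < m) _; set y := x + m.+1 * r.
set N := L * m`! * r ^ m => xP_dvd Py_dvd.
have -> : L * m.+1`! * r ^ m.+1 = N * y - N * x.
  by rewrite -mulnBr /y addKn factS expnS /N; lia.
apply: dvdn_sub; first by rewrite mulnA dvdn_mul.
by rewrite mulnC dvdn_mul.
Qed.

Lemma coprime_ap_term (u0 r k : nat) :
  coprime u0 r -> coprime (ap_term u0 r k) r.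
Proof. by rewrite /ap_term addnC ![coprime _ r]coprime_sym /coprime gcdnMDl. Qed.

Lemma coprime_prod_ap (r x m : nat) :
  coprime x r -> coprime (\prod_(i < m) (x + i * r)) r.
Proof.
move=> co_xr; apply: (big_ind (fun y => coprime y r)) => [|y z co_yr co_zr|i _].
- exact: coprime1n.
- by rewrite coprimeMl co_yr.
- exact: coprime_ap_term.
Qed.

(** The product is coprime to [r], so Gauss's lemma removes the factor [r ^ m]. *)
Lemma prod_ap_dvdn_mul_fact (r L m x : nat) :
  coprime x r -> (forall i, i <= m -> x + i * r %| L) ->
  \prod_(i < m.+1) (x + i * r) %| L * m`!.
Proof.
move=> co_xr /prod_ap_dvdn_mul_expn.
by rewrite Gauss_dvdl // coprimeXr // coprime_prod_ap.
Qed.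

Lemma fact_dvdn_fact (m n : nat) : m <= n -> m`! %| n`!.
Proof. by move=> /bin_fact <-; rewrite mulnCA dvdn_mulr. Qed.

(** From [e] to [e.+1], the factorial gains the factor [e.+1 * r]. *)
Lemma expn_dvdn_fact (r e m : nat) : 0 < r -> e * r <= m -> r ^ e %| m`!.
Proof.
case: r => // r _ /fact_dvdn_fact; apply: dvdn_trans.
elim: e => [|e IHe]; first exact: dvd1n.
rewrite mulSn addSn factS expnS -addSn -mulSn.
apply: dvdn_mul; first exact: dvdn_mull.
by apply: dvdn_trans IHe (fact_dvdn_fact _ _ (leq_addl _ _)).
Qed.

Lemma ap_term_dvdn_ap_lcm (u0 r n i : nat) :
  i <= n -> ap_term u0 r i %| ap_lcm u0 r n.
Proof.
move=> le_in; rewrite /ap_lcm.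
exact: (@biglcmn_sup _ (Ordinal (le_in : i < n.+1))).
Qed.

Lemma ap_lcm_gt0 (u0 r n : nat) : 0 < u0 -> 0 < ap_lcm u0 r n.
Proof.
move=> u0_gt0; apply: (big_ind (fun y => 0 < y)) => // [x y|i _].
  by rewrite lcmn_gt0 => -> ->.
by rewrite /ap_term addn_gt0 u0_gt0.
Qed.

(* When [n] increases to [n.+1], [k] has to move only if [n = u0 + k * r.+1];
   then [u_k = n - k] and replacing [k] by [k.+1] does not change the quotient
   [u_k ... u_n / (n - k)!]. *)
Lemma exists_large_prod_ap (u0 r n : nat) : 0 < u0 -> exists k m,
  [/\ k + m = n, n <= u0 + k * r.+1, k * r.+1 <= n + r
    & u0 * r.+1 ^ n * m`! <= \prod_(i < m.+1) (ap_term u0 r k + i * r)].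
Proof.
move=> u0_gt0; elim: n => [|n [k [m [kmn le_n le_k le_prod]]]].
  by exists 0, 0; split=> //; rewrite big_ord1 /ap_term !muln1 addn0 leq_addr.
case: (ltnP n (u0 + k * r.+1)) => [lt_n|ge_n].
  exists k, m.+1; split; [lia | by [] | lia |].
  rewrite big_ord_recr /= factS expnS.
  (* Cancelling [m.+1 * r] leaves [m.+1 <= u_k], which is [lt_n] as [k + m = n]. *)
  have le_last : r.+1 * m.+1 <= ap_term u0 r k + m.+1 * r.
    rewrite mulSn [r * _]mulnC leq_add2r /ap_term.
    by move: lt_n; rewrite mulnS; lia.
  rewrite [r.+1 * _]mulnC [m.+1 * _]mulnC [u0 * (_ * _)]mulnA mulnACA.
  exact: leq_mul.
case: m => [|m] in kmn le_prod *; first by nia.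
exists k.+1, m.+1; split; [lia | nia | nia |].
have uk : ap_term u0 r k = m.+1 by rewrite /ap_term; nia.
have uk1 : ap_term u0 r k.+1 = ap_term u0 r k + r by rewrite /ap_term; lia.
move: le_prod; rewrite prod_ap_recl uk1 [\prod_(i < m.+2) _]big_ord_recr /=.
rewrite {1}uk factS mulnCA leq_pmul2l // => le_prod.
have le_last : r.+1 * m.+1 <= ap_term u0 r k + r + m.+1 * r by rewrite uk; nia.
rewrite expnS [r.+1 * _]mulnC [m.+1 * _]mulnC [u0 * (_ * _)]mulnA mulnACA.
exact: leq_mul.
Qed.

Lemma ap_lcm_ge (u0 r n e : nat) :
  0 < u0 -> 0 < r -> coprime u0 r -> e * r.+1 <= n ->
  u0 * r ^ e * r.+1 ^ n <= ap_lcm u0 r n.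
Proof.
move=> u0_gt0 r_gt0 co_u0r le_en.
have [k [m [kmn _ le_k le_prod]]] := exists_large_prod_ap u0 r n u0_gt0.
(* Over the integers, [(r + 1) m >= r (n - 1) >= e r (r + 1) - r], so [m > e r - 1]. *)
have le_erm : e * r <= m by nia.
have co_ukr := coprime_ap_term u0 r k co_u0r.
have prod_dvd :
    \prod_(i < m.+1) (ap_term u0 r k + i * r) %| ap_lcm u0 r n * m`!.
  apply: prod_ap_dvdn_mul_fact => // i le_im.
  by rewrite /ap_term -addnA -mulnDl; apply: ap_term_dvdn_ap_lcm; lia.
have /dvdn_leq : r ^ e * \prod_(i < m.+1) (ap_term u0 r k + i * r)
    %| ap_lcm u0 r n * m`!.
  rewrite Gauss_dvd ?prod_dvd ?andbT.
    by rewrite dvdn_mull // expn_dvdn_fact.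
  by rewrite coprimeXl // coprime_sym coprime_prod_ap.
rewrite muln_gt0 ap_lcm_gt0 // fact_gt0 => /(_ isT) le_L.
rewrite -(leq_pmul2r (fact_gt0 m)); apply: leq_trans le_L.
by rewrite [u0 * _]mulnC -!mulnA leq_mul2l mulnA le_prod orbT.
Qed.

Theorem theorem1p4 (u0 r : nat) (hu0 : 1 <= u0) (hr : 1 <= r)
    (hcop : gcdn u0 r = 1) (a : nat) (ha : 2 <= a) (alpha : nat)
    (halpha : a <= alpha) (hra : a <= r) (n : nat) (hn : 3 * alpha * r <= n) :
  u0 * r ^ (2 * alpha + a - 3) * (r + 1) ^ n <= ap_lcm u0 r n.
Proof.
rewrite addn1; apply: ap_lcm_ge => //; first exact/eqP.
apply: leq_trans hn.
(* The difference [3 alpha r - (2 alpha + a - 3) (r + 1)] equals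
   [(alpha - a) (r - 2) + 3 (r - a + 1)], which is positive. *)
have [b def_a] : exists b, a = b.+2 by exists (a - 2); lia.
have [c def_alpha] : exists c, alpha = a + c by exists (alpha - a); lia.
have [d def_r] : exists d, r = a + d by exists (r - a); lia.
nia.
Qed.
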